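(* Let $k$ be an algebraically closed field of characteristic $p>0$ and let $n\ge 1$. Let $\mathcal X\subset\mathbb P^{n+1}$ be an irreducible hypersurface of degree $d\ge 3$ over $k$ with an extendable Galois point $P\in\mathbb P^{n+1}$, let $m$ be the multiplicity of $\mathcal X$ at $P$, and let $G$ be the Galois group of the projection $\pi_P\colon\mathcal X\dashrightarrow\mathbb P^n$. Assume that $p$ divides $d-m$, and write $d-m=p^u l$ with $\gcd(p,l)=1$. Then: (1) The number $l$ divides $p^u-1$. (2) The group $G$ is isomorphic to a semidirect product $(\mathbb Z/p\mathbb Z)^{\oplus u}\rtimes\mathbb Z/l\mathbb Z$.
   Context: For an irreducible hypersurface $\mathcal X\subset\mathbb P^{n+1}$ of degree $d\ge3$ and a point $P\in\mathbb P^{n+1}$ (on $\mathcal X$ or not), $\pi_P\colon\mathcal X\dashrightarrow\mathbb P^n$ denotes the projection with center $P$. Let $m$ be the multiplicity of $\mathcal X$ at $P$ ($m=0$ if $P\notin\mathcal X$). The map $\pi_P$ is assumed dominant (i.e. $m<d$), so it induces a field extension $\pi_P^*\colon k(\mathbb P^n)\hookrightarrow k(\mathcal X)$ of degree $d-m$. The point $P$ is a Galois point for $\mathcal X$ if $k(\mathcal X)/k(\mathbb P^n)$ is a Galois extension; the Galois group of $\pi_P$ is the Galois group of this extension. Automorphisms of $k(\mathcal X)$ over $k$ are identified with birational self-maps of $\mathcal X$ via pullback. The Galois point $P$ is extendable if the Galois group is given by a subgroup of $\mathrm{PGL}(n+2,k)$, i.e. every element of it is the restriction to $\mathcal X$ of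 an element of $\mathrm{PGL}(n+2,k)$ preserving $\mathcal X$. *)

(* Defs.v *)
From HB Require Import structures.
From mathcomp Require Import all_boot all_order all_fingroup all_algebra.
From mathcomp Require Import all_solvable all_field.
From mathcomp Require Export mpoly.

Set Implicit Arguments.
Unset Strict Implicit.
Unset Printing Implicit Defensive.

Import GRing.Theory.
Local Open Scope ring_scope.

(* Points of projective space are given by nonzero row vectors of homogeneous
   coordinates, and matrices act on them by right multiplication. *)

Definition mpoly_dvd (N : nat) (k : fieldType) (F G : {mpoly k[N]}) : Prop :=
  exists Q : {mpoly k[N]}, G = Q * F.

Definition mpoly_irreducible (N : nat) (k : fieldType)
    (F : {mpoly k[N]}) : Prop :=
  [/\ F != 0, F \isn't a GRing.unit
    & forall G H : {mpoly k[N]},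
        F = G * H -> G \is a GRing.unit \/ H \is a GRing.unit].

(* The value of G at a point x with coordinates in an extension c : k -> K. *)
Definition eval_at (N : nat) (k K : fieldType) (c : {rmorphism k -> K})
    (x : 'rV[K]_N) (G : {mpoly k[N]}) : K :=
  mmap c (fun i => x 0 i) G.

(* K, with generic point x, is the function field of the irreducible
   subvariety V(F) of P^(N-1): its elements are the fractions A/B of forms of
   the same degree with B not in (F), a form being zero on V(F) exactly when
   F divides it; the fraction A/B is A(x)/B(x).  The homogeneous coordinates x
   matter only up to a common factor: x may be (X_0/X_j : ... : X_(N-1)/X_j)
   for any X_j that F does not divide.  For F = 0 this is the function field
   of P^(N-1), since 0 divides only 0. *)
Definition function_field (N : nat) (k K : fieldType) (F : {mpoly k[N]})
    (c : {rmorphism k -> K}) (x : 'rV[K]_N) : Prop :=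
  (forall (e : nat) (G : {mpoly k[N]}), G \is e.-homog ->
     (eval_at c x G = 0 <-> mpoly_dvd F G)) /\
  (forall z : K, exists e : nat, exists A B : {mpoly k[N]},
     [/\ A \is e.-homog, B \is e.-homog, ~ mpoly_dvd F B
       & z = eval_at c x A / eval_at c x B]).

(* f : k(V(F1)) -> k(Z) is the pullback of rational functions along the
   rational map Z --> V(F1) induced by the linear map with matrix M, where
   x1 and x2 are the generic points of V(F1) and Z. *)
Definition linear_pullback (N1 N2 : nat) (k K1 K2 : fieldType)
    (F1 : {mpoly k[N1]})
    (c1 : {rmorphism k -> K1}) (x1 : 'rV[K1]_N1)
    (c2 : {rmorphism k -> K2}) (x2 : 'rV[K2]_N2)
    (M : 'M[k]_(N2, N1)) (f : K1 -> K2) : Prop :=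
  forall (e : nat) (A B : {mpoly k[N1]}),
    A \is e.-homog -> B \is e.-homog -> ~ mpoly_dvd F1 B ->
    f (eval_at c1 x1 A / eval_at c1 x1 B)
      = eval_at c2 (x2 *m map_mx c2 M) A / eval_at c2 (x2 *m map_mx c2 M) B.

(* M : 'M_(N.+1, N) defines the projection P^N --> P^(N-1) with center P;
   M is determined by P up to a projectivity of the target. *)
Definition projection_from (N : nat) (k : fieldType) (P : 'rV[k]_N.+1)
    (M : 'M[k]_(N.+1, N)) : Prop :=
  \rank M = N /\ P *m M = 0.

(* The equation of V(F) in the affine chart x_i = P_i, with the origin moved
   to P. *)
Definition local_equation (N : nat) (k : fieldType) (F : {mpoly k[N]})
    (P : 'rV[k]_N) (i : 'I_N) : {mpoly k[N]} :=
  F \mPo [tuple (P 0 j)%:MP + (if j == i then 0 else 'X_j) | j < N].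

(* The least degree of a monomial of f (0 if f = 0). *)
Definition mpoly_order (N : nat) (k : fieldType) (f : {mpoly k[N]}) : nat :=
  \big[minn/msize f]_(mu <- msupp f) mdeg mu.

Definition multiplicity (N : nat) (k : fieldType) (F : {mpoly k[N]})
    (P : 'rV[k]_N) : nat :=
  if [pick i | P 0 i != 0] is Some i then mpoly_order (local_equation F P i)
  else 0%N.

Definition preserves (N : nat) (k : fieldType) (F : {mpoly k[N]})
    (A : 'M[k]_N) : Prop :=
  forall Q : 'rV[k]_N,
    (F.@[fun i => (Q *m A) 0 i] == 0) = (F.@[fun i => Q 0 i] == 0).

(* The automorphism s of K = k(V(F)) is given by an element of PGL(N, k). *)
Definition linearly_induced (N : nat) (k K : fieldType) (F : {mpoly k[N]})
    (c : {rmorphism k -> K}) (x : 'rV[K]_N) (s : K -> K) : Prop :=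
  exists A : 'M[k]_N,
    [/\ A \in unitmx, preserves F A & linear_pullback F c x c x A s].

(* Main.v *)
Require Import Defs.
From HB Require Import structures.
From mathcomp Require Import all_boot all_order all_fingroup all_algebra.
From mathcomp Require Import all_solvable all_field mxabelem.
From mathcomp Require Import mpoly.

Set Implicit Arguments.
Unset Strict Implicit.
Unset Printing Implicit Defensive.

Import GRing.Theory.
Local Open Scope ring_scope.

(* On the lines through P the function field L of X is generated over E by one
   coordinate t, whose equation over E is F restricted to the generic line
   through P; its degree is d - m, so the Galois group G has order d - m.
   A matrix A inducing an element s of G fixes P: the condition that s is the
   identity on E says that some quadratic forms vanish on X, hence vanish
   identically as d > 2.  Therefore s t = a t + b with a, b in E, and G is a
   group of affine transformations.  Its translations form the kernel N of the
   homomorphism s |-> a.  They are an elementary abelian p-group, and the image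
   of G in E^* has no p-torsion and is cyclic; so N has order p^u, it has a
   cyclic complement H of order l by Schur-Zassenhaus, and H acts freely on
   the nontrivial translations, which it multiplies by the scalars a. *)

(** * Forms and linear substitutions *)

Section Forms.

Lemma mpoly_rmorph_ext (N : nat) (R S : nzRingType)
    (f g : {rmorphism {mpoly R[N]} -> S}) :
  (forall c, f c%:MP = g c%:MP) -> (forall j, f 'X_j = g 'X_j) -> f =1 g.
Proof.
move=> eqC eqX G; rewrite (mpolyE G) !raddf_sum; apply: eq_bigr => mu _.
rewrite /= -mul_mpolyC !rmorphM /= eqC; congr (_ * _).
rewrite mpolyXE_id !rmorph_prod; apply: eq_bigr => j _ /=.
by rewrite !rmorphXn eqX.
Qed.

(** Induction principle for homogeneity: degrees add along products and are kept by sums, so only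
    constants and variables have to be checked. It serves both linear substitution and expansion
    along lines. *)
Lemma mmap_graded (N : nat) (R : nzRingType) (S : comNzRingType)
    (f : {rmorphism R -> S}) (h : 'I_N -> S) (D : nat -> S -> Prop) :
    (forall e, D e 0) -> (forall e u v, D e u -> D e v -> D e (u + v)) ->
    (forall e e' u v, D e u -> D e' v -> D (e + e')%N (u * v)) ->
    (forall c, D 0%N (f c)) -> (forall j, D 1%N (h j)) ->
  forall (e : nat) (G : {mpoly R[N]}), G \is e.-homog -> D e (mmap f h G).
Proof.
move=> D0 DD DM DC Dh e G /dhomogP homG; rewrite /mmap big_seq.
apply: big_ind => [||mu mu_G]; [exact: D0 | exact: DD |].
rewrite -[e]add0n -(homG mu mu_G); apply: (DM); first exact: DC.
rewrite /mmap1 /= mdegE; apply: (big_rec2 (fun u a => D a u)) => [|j u a _ Da].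
  by rewrite -(rmorph1 f); apply: DC.
apply: (DM) => //; elim: (mu j) => [|b IHb].
  by rewrite expr0 -(rmorph1 f); apply: DC.
by rewrite exprS -add1n; apply: (DM).
Qed.

(** Pullback of forms along the map [v |-> v *m M] of row vectors. *)
Definition lin_subst (k : fieldType) (N1 N2 : nat) (M : 'M[k]_(N2, N1)) :
    {mpoly k[N1]} -> {mpoly k[N2]} :=
  mmap (@mpolyC N2 k) (fun j => \sum_i M i j *: 'X_i).

HB.instance Definition _ k N1 N2 M :=
  GRing.RMorphism.copy (@lin_subst k N1 N2 M)
    (mmap (@mpolyC N2 k) (fun j => \sum_i M i j *: 'X_i)).

HB.instance Definition _ N (k K : fieldType) (c : {rmorphism k -> K}) x :=
  GRing.RMorphism.copy (@eval_at N k K c x) (mmap c (fun j => x 0 j)).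

Variable k : fieldType.

Section Substitution.

Variables (N1 N2 : nat).
Implicit Types (M : 'M[k]_(N2, N1)) (G : {mpoly k[N1]}).

Lemma lin_substC M c : lin_subst M c%:MP = c%:MP.
Proof. exact: mmapC. Qed.

Lemma lin_substX M j : lin_subst M 'X_j = \sum_i M i j *: 'X_i.
Proof. by rewrite /lin_subst mmapX mmap1U. Qed.

Lemma lin_substZ M a G : lin_subst M (a *: G) = a *: lin_subst M G.
Proof. by rewrite -!mul_mpolyC rmorphM /= lin_substC. Qed.

Lemma lin_subst_homog M e G : G \is e.-homog -> lin_subst M G \is e.-homog.
Proof.
move: e G; apply: (mmap_graded (D := fun e (H : {mpoly k[N2]}) => H \is e.-homog)).
- by move=> e; apply: dhomog0.
- by move=> e u v; apply: dhomogD.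
- by move=> e e' u v; apply: dhomogM.
- by move=> c /=; rewrite -[c%:MP]mulr1 mul_mpolyC dhomogZ ?dhomog1.
- move=> j; apply: rpred_sum => i _; apply: dhomogZ.
  by rewrite dhomogX /= mdeg1.
Qed.

End Substitution.

Section Evaluation.

Variables (K : fieldType) (c : {rmorphism k -> K}).

Lemma eval_atC N (x : 'rV[K]_N) a : eval_at c x a%:MP = c a.
Proof. exact: mmapC. Qed.

Lemma eval_atX N (x : 'rV[K]_N) j : eval_at c x 'X_j = x 0 j.
Proof. by rewrite /eval_at mmapX mmap1U. Qed.

Lemma eval_atZ N (x : 'rV[K]_N) a G : eval_at c x (a *: G) = c a * eval_at c x G.
Proof. by rewrite -mul_mpolyC rmorphM /= eval_atC. Qed.

Lemma eval_lin_subst N1 N2 (x : 'rV[K]_N2) (M : 'M[k]_(N2, N1)) G :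
  eval_at c x (lin_subst M G) = eval_at c (x *m map_mx c M) G.
Proof.
apply: (mpoly_rmorph_ext (f := eval_at c x \o lin_subst M)) G => [a | j] /=.
  by rewrite lin_substC !eval_atC.
rewrite lin_substX raddf_sum eval_atX mxE; apply: eq_bigr => i _.
by rewrite /= eval_atZ eval_atX mxE mulrC.
Qed.

Lemma eval_scale N (a : K) (x : 'rV[K]_N) e G :
  G \is e.-homog -> eval_at c (a *: x) G = a ^+ e * eval_at c x G.
Proof.
move=> /dhomogP homG; rewrite /eval_at /mmap mulr_sumr !big_seq.
apply: eq_bigr => mu /homG mu_e; rewrite mulrCA; congr (_ * _).
rewrite -mu_e /= mdegE -prodrXr -big_split; apply: eq_bigr => j _ /=.
by rewrite mxE exprMn.
Qed.

End Evaluation.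

Lemma lin_subst_comp N1 N2 N3 (M : 'M[k]_(N3, N2)) (N : 'M[k]_(N2, N1)) G :
  lin_subst M (lin_subst N G) = lin_subst (M *m N) G.
Proof.
apply: (mpoly_rmorph_ext (f := lin_subst M \o lin_subst N)) G => [a | j] /=.
  by rewrite !lin_substC.
rewrite !lin_substX raddf_sum /=.
under eq_bigr => i _ do rewrite lin_substZ lin_substX scaler_sumr.
rewrite exchange_big; apply: eq_bigr => i _ /=; rewrite mxE scaler_suml.
by apply: eq_bigr => l _; rewrite scalerA mulrC.
Qed.

Lemma lin_subst1 N (G : {mpoly k[N]}) : lin_subst 1%:M G = G.
Proof.
apply: (mpoly_rmorph_ext (f := lin_subst 1%:M) (g := idfun)) G => [a | j] /=.
  by rewrite lin_substC.
rewrite lin_substX (bigD1 j) //= mxE eqxx scale1r big1 ?addr0 // => i /negbTE nij.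
by rewrite mxE nij scale0r.
Qed.

(** Over a field the degrees of nonzero factors add, so a nonzero multiple of [F] has degree at
    least [d]. *)
Lemma mpoly_dvd_small N (F G : {mpoly k[N]}) d e :
    F \is d.-homog -> F != 0 -> G \is e.-homog -> (e < d)%N ->
  mpoly_dvd F G -> G = 0.
Proof.
move=> homF nzF homG lt_ed [Q defG]; apply/eqP; apply: contraTT lt_ed => nzG.
have nzQ : Q != 0 by apply: contraNneq nzG => Q0; rewrite defG Q0 mul0r.
have msz H r : H \is r.-homog -> H != 0 -> msize H = r.+1.
  move=> homH nzH; have := dhomog_uniq nzH homH (dhomog_msize homH).
  by move=> ->; rewrite prednK // lt0n msize_poly_eq0.
have := msizeM nzQ nzF; rewrite -defG (msz _ _ G _ homG) // (msz _ _ F _ homF) //.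
rewrite addnS /= => eq_e; rewrite -leqNgt -ltnS eq_e -[d.+1]add1n leq_add2r.
by rewrite lt0n msize_poly_eq0.
Qed.

End Forms.

(** * Expansion of a form along the lines through a point *)

Lemma big_minn_eq (T : eqType) (s : seq T) (f : T -> nat) (i0 : nat) (x : T) :
    x \in s -> (f x <= i0)%N -> {in s, forall z, f x <= f z}%N ->
  \big[minn/i0]_(z <- s) f z = f x.
Proof.
move=> xs le_i0 le_s; apply/eqP; rewrite eqn_leq; apply/andP; split.
  elim: s xs {le_s} => // z s IHs; rewrite inE big_cons geq_min.
  by case/predU1P=> [->|/IHs->]; rewrite ?leqnn ?orbT.
rewrite big_seq; apply: (big_ind (fun a => f x <= a)%N) => // a b le_a le_b.
by rewrite leq_min le_a.
Qed.

Section ExpansionAtPoint.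

Variables (k : fieldType) (N : nat) (P : 'rV[k]_N) (i : 'I_N).
Hypothesis Pi : P 0 i != 0.

(* Restricts a form to the lines through P, with 'X a parameter on the line:
   the point of parameter T on the line through X' is T P + X', where X' lies
   on the hyperplane of equation X_i = 0. *)
Definition line_expand : {mpoly k[N]} -> {poly {mpoly k[N]}} :=
  mmap (polyC \o @mpolyC N k)
    (fun j => (P 0 j)%:MP *: 'X + (if j == i then 0 else 'X_j)%:P).

HB.instance Definition _ :=
  GRing.RMorphism.copy line_expand
    (mmap (polyC \o @mpolyC N k)
      (fun j => (P 0 j)%:MP *: 'X + (if j == i then 0 else 'X_j)%:P)).

Lemma line_expandC a : line_expand a%:MP = a%:MP%:P.
Proof. exact: mmapC. Qed.

Lemma line_expandX j : line_expand 'X_j =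
  (P 0 j)%:MP *: 'X + (if j == i then 0 else 'X_j)%:P.
Proof. by rewrite /line_expand mmapX mmap1U. Qed.

Lemma line_expandZ a G : line_expand (a *: G) = a%:MP *: line_expand G.
Proof. by rewrite -mul_mpolyC rmorphM /= line_expandC mul_polyC. Qed.

(** Both sides are ring morphisms in [G], hence agree once they agree on constants and variables.
    The parameter [r] is specialised below to [X_i / P_i], to 1 and to the coordinate of the generic
    point on its line. *)
Lemma line_expand_horner (S : comNzRingType)
    (g : {rmorphism {mpoly k[N]} -> S}) (r : S) (f : {rmorphism {mpoly k[N]} -> S}) :
    (forall a, g a%:MP = f a%:MP) ->
    (forall j, g (P 0 j)%:MP * r + (if j == i then 0 else g 'X_j) = f 'X_j) ->
  forall G, (map_poly g (line_expand G)).[r] = f G.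
Proof.
move=> eqC eqX G.
apply: (mpoly_rmorph_ext (f := horner_eval r \o map_poly g \o line_expand)).
  by move=> a /=; rewrite /horner_eval line_expandC map_polyC hornerC; apply: eqC.
move=> j /=; rewrite /horner_eval line_expandX rmorphD /= map_polyZ map_polyX.
rewrite map_polyC !hornerE; apply: etrans (eqX j); congr (_ + _).
by case: ifP => // _; apply: rmorph0.
Qed.

(** The linear projection along [P] onto the hyperplane [X_i = 0], that is
    [v |-> v - (v_i / P_i) P]. *)
Definition line_proj : 'M[k]_N := 1%:M - (P 0 i)^-1 *: (delta_mx i 0 *m P).

(** Any vector is recovered as [(X_i / P_i) P] plus its projection to [X_i = 0]. *)
Lemma line_expandK G :
  (map_poly (lin_subst line_proj) (line_expand G)).[(P 0 i)^-1 *: 'X_i] = G.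
Proof.
apply: (line_expand_horner (f := idfun)) => [a | j] /=; first exact: lin_substC.
have projE a b : line_proj a b = (a == b)%:R - (a == i)%:R * (P 0 i)^-1 * P 0 b.
  rewrite !mxE big_ord1 !mxE eqxx andbT; congr (_ - _).
  by rewrite mulrCA mulrA.
rewrite lin_substC -scalerAr mul_mpolyC scalerA.
case: eqP => [->|/eqP nji]; first by rewrite mulVf // scale1r addr0.
rewrite lin_substX (bigD1 i) //= (bigD1 j) //= big1 => [|l /andP[nli nlj]].
  rewrite !projE eqxx [i == j]eq_sym (negbTE nji) eqxx !mul0r subr0 scale1r addr0.
  by rewrite sub0r mul1r scaleNr addrA subrr add0r.
by rewrite projE (negbTE nli) (negbTE nlj) !mul0r subr0 scale0r.
Qed.

Lemma line_expand_inj : injective line_expand.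
Proof. by move=> G H eqGH; rewrite -[G]line_expandK eqGH line_expandK. Qed.

Lemma line_expand1 G : (line_expand G).[1] = local_equation G P i.
Proof.
rewrite -[line_expand G](map_poly_id (g := idfun)) //.
apply: (line_expand_horner (g := idfun) (f := comp_mpoly _)) => [a | j] /=.
  by rewrite comp_mpolyC.
by rewrite comp_mpolyXU -tnth_nth tnth_mktuple mulr1.
Qed.

(** Each variable is sent to an expression of degree one when the line parameter has weight one, so
    the total degree is preserved. *)
Lemma line_expand_graded d G j m : G \is d.-homog ->
  ((line_expand G)`_j)@_m != 0 -> (mdeg m + j)%N = d.
Proof.
pose D e (q : {poly {mpoly k[N]}}) := forall j m, q`_j@_m != 0 -> (mdeg m + j)%N = e.
suff gradD : forall e G, G \is e.-homog -> D e (line_expand G).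
  by move=> homG; apply: gradD.
apply: (mmap_graded (D := D)) => [e j' m' | e u v Du Dv j' m' | e e' u v Du Dv j' m' | |].
- by rewrite coef0 mcoeff0 eqxx.
- rewrite coefD mcoeffD; have [u0|nzu _] := eqVneq u`_j'@_m' 0; last exact: Du.
  by rewrite u0 add0r; apply: Dv.
- rewrite coefM raddf_sum /= => nz.
  have [a nza] : exists a : 'I_j'.+1, (u`_a * v`_(j' - a))@_m' != 0.
    apply/existsP; apply: contraNT nz => /existsPn z; rewrite big1 // => a _.
    exact/eqP/negPn/z.
  have /msuppM_le/allpairsP[[m1 m2] /= [m1u m2v ->]] :
    m' \in msupp (u`_a * v`_(j' - a)) by rewrite mcoeff_msupp.
  rewrite !mcoeff_msupp in m1u m2v.
  rewrite -(Du _ _ m1u) -(Dv _ _ m2v) mdegD -[in LHS](subnKC (leq_ord a)).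
  by rewrite addnACA.
- move=> a j' m' /=; rewrite coefC; case: ifP => [/eqP->|_]; rewrite ?mcoeff0 ?eqxx //.
  by rewrite mcoeffC; have [->|] := eqVneq m' 0%MM; rewrite ?mdeg0 ?mulr0 ?eqxx.
- move=> l j' m'; rewrite coefD coefZ coefX coefC.
  case: j' => [|[|j']] /=; rewrite ?mulr0 ?mulr1 ?add0r ?addr0 ?mcoeff0 ?eqxx //.
    case: ifP => _; rewrite ?mcoeff0 ?eqxx // mcoeffX addn0.
    by case: (eqVneq U_(l)%MM m') => [<-|]; rewrite ?mdeg1 ?eqxx.
  by rewrite mcoeffC; have [->|] := eqVneq m' 0%MM; rewrite ?mdeg0 ?mulr0 ?eqxx.
Qed.

(** The coefficient of the [j]-th power of the parameter is a form of degree [d - j]. Setting the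
    parameter to 1 therefore cancels nothing, and the terms of least degree of the local equation
    come from the top power. *)
Lemma order_line_expand d F : F != 0 -> F \is d.-homog ->
  (mpoly_order (local_equation F P i) + (size (line_expand F)).-1)%N = d.
Proof.
move=> nzF homF; set q := line_expand F.
have nzq : q != 0 by rewrite -(raddf0 line_expand) (inj_eq line_expand_inj).
have q_gt0 : (0 < size q)%N by rewrite size_poly_gt0.
have [mu nz_mu] : exists mu, (lead_coef q)@_mu != 0.
  have := nzq; rewrite -lead_coef_eq0 -msupp_eq0.
  case: (msupp _) (mcoeff_msupp (lead_coef q)) => // mu s supp _.
  by exists mu; rewrite -supp mem_head.
have coef_loc m : (local_equation F P i)@_m = \sum_(j < size q) q`_j@_m.
  rewrite -line_expand1 horner_coef raddf_sum; apply: eq_bigr => j _ /=.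
  by rewrite expr1n mulr1.
have deg_mu := line_expand_graded homF nz_mu.
have mu_loc : mu \in msupp (local_equation F P i).
  rewrite mcoeff_msupp coef_loc.
  have lt_q : ((size q).-1 < size q)%N by rewrite prednK.
  rewrite (bigD1 (Ordinal lt_q)) //= big1 ?addr0 // => j nj.
  apply: contraNeq nj => /(line_expand_graded homF); rewrite -deg_mu.
  by move/addnI => eq_j; apply/eqP/val_inj.
rewrite /mpoly_order (big_minn_eq mu_loc (ltnW (msize_mdeg_lt mu_loc))) // => nu.
rewrite mcoeff_msupp coef_loc => nz.
have [j /(line_expand_graded homF) deg_nu] : exists j : 'I_(size q), q`_j@_nu != 0.
  apply/existsP; apply: contraNT nz => /existsPn z; rewrite big1 // => j _.
  exact/eqP/negPn/z.
rewrite -(leq_add2r j) deg_nu -deg_mu leq_add2l -ltnS prednK //.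
Qed.

End ExpansionAtPoint.

(** * Degree of the projection *)

Section Projection.

Variables (k : fieldType) (N : nat) (P : 'rV[k]_N.+1) (i : 'I_N.+1).
Hypothesis Pi : P 0 i != 0.
Variable M : 'M[k]_(N.+1, N).
Hypothesis M_proj : projection_from P M.

(* The inverse of the restriction of M to the hyperplane X_i = 0. *)
Definition section_mx : 'M[k]_(N, N.+1) := pinvmx M *m line_proj P i.

Lemma line_projP : P *m line_proj P i = 0.
Proof.
rewrite /line_proj mulmxBr mulmx1 -scalemxAr mulmxA.
have -> : P *m delta_mx i (0 : 'I_1) = (P 0 i)%:M.
  apply/matrixP=> a b; rewrite !ord1 -colE !mxE eqxx mulr1n.
  by [].
by rewrite mul_scalar_mx scalerA mulVf // scale1r subrr.
Qed.

Lemma section_mxK : section_mx *m M = 1%:M.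
Proof.
have [rM PM] := M_proj.
have lineM : line_proj P i *m M = M.
  by rewrite mulmxBl mul1mx -scalemxAl -mulmxA PM mulmx0 scaler0 subr0.
by rewrite /section_mx -(mulmxA (pinvmx M)) lineM mulVpmx // /row_full rM.
Qed.

(** The rows of [1%:M - M *m pinvmx M] lie in the kernel of [M], which has dimension one and is
    spanned by [P]; and [line_proj] kills [P]. *)
Lemma mul_section_mx : M *m section_mx = line_proj P i.
Proof.
have [rM PM] := M_proj.
apply/eqP; rewrite eq_sym -subr_eq0 mulmxA -{1}[line_proj P i]mul1mx -mulmxBl.
have sMP : (kermx M <= P)%MS.
  have PkM : (P <= kermx M)%MS by apply/sub_kermxP.
  have nzP : P != 0 by apply: contraNneq Pi => ->; rewrite mxE.
  rewrite -(geq_leqif (mxrank_leqif_sup PkM)) mxrank_ker rM subSnn.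
  by rewrite rank_rV nzP.
have /submxP[C ->] : (1%:M - M *m pinvmx M <= P)%MS.
  apply: submx_trans sMP; apply/sub_kermxP.
  by rewrite mulmxBl mul1mx mulmxKpV ?subrr.
by rewrite -mulmxA line_projP mulmx0.
Qed.

Lemma section_mx_i j : section_mx j i = 0.
Proof.
rewrite mxE big1 // => l _.
have -> : line_proj P i l i = 0; last by rewrite mulr0.
by rewrite !mxE big_ord1 !mxE eqxx andbT mulrCA mulVf // mulr1 subrr.
Qed.

End Projection.

(** * Homogeneous coordinates of generic points *)

Section GenericPoints.

Variables (k K : fieldType) (c : {rmorphism k -> K}).

(** Numerator and denominator have the same degree, so the scaling factors cancel. This permits
    normalising the coordinates of the generic points. *)
Lemma function_field_scale N (F : {mpoly k[N]}) (x : 'rV[K]_N) (a : K) :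
  a != 0 -> function_field F c x -> function_field F c (a *: x).
Proof.
move=> nza [ev0 frac]; split=> [e G homG | z].
  rewrite (eval_scale _ _ _ homG) -(ev0 e) //; split=> [/eqP | ->]; last first.
    by rewrite mulr0.
  by rewrite mulf_eq0 expf_eq0 (negbTE nza) andbF => /eqP.
have [e [A [B [homA homB nFB ->]]]] := frac z; exists e, A, B; split=> //.
by rewrite !(eval_scale _ _ _ homA, eval_scale _ _ _ homB) -mulf_div divff ?mul1r ?expf_neq0.
Qed.

Lemma linear_pullback_scale N1 N2 (K' : fieldType) (c' : {rmorphism k -> K'})
    (F : {mpoly k[N1]}) (x : 'rV[K]_N1) (x' : 'rV[K']_N2) M f a a' :
  a != 0 -> a' != 0 -> linear_pullback F c x c' x' M f ->
  linear_pullback F c (a *: x) c' (a' *: x') M f.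
Proof.
move=> nza nza' pull e A B homA homB nFB.
rewrite -scalemxAl !(eval_scale _ _ _ homA, eval_scale _ _ _ homB).
by rewrite -!mulf_div !divff ?mul1r ?expf_neq0 //; apply: (pull e).
Qed.

Variables (N : nat) (y : 'rV[K]_N).
Hypothesis K_PN : function_field 0 c y.

Lemma eval_generic_eq0 e G : G \is e.-homog -> (eval_at c y G == 0) = (G == 0).
Proof.
move=> homG; apply/eqP/eqP => [/(K_PN.1 e G homG)[Q ->]|->]; rewrite ?mulr0 //.
exact: rmorph0.
Qed.

Lemma common_denominator (r : nat -> K) (s : nat) : exists e A B,
  [/\ B \is e.-homog, eval_at c y B != 0 &
      forall j, (j < s)%N -> A j \is e.-homog /\ r j = eval_at c y (A j) / eval_at c y B].
Proof.
elim: s => [|s [e [A [B [homB nzB AB]]]]].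
  exists 0%N, (fun=> 0), 1; split=> //; first exact: dhomog1.
  by rewrite rmorph1 oner_eq0.
have [e' [A' [B' [homA' homB' nB' rs]]]] := K_PN.2 (r s).
have nzB' : eval_at c y B' != 0.
  by rewrite (eval_generic_eq0 homB'); apply: contra_notN nB' => /eqP->; exists 0; rewrite mulr0.
exists (e + e')%N, (fun j => if j == s then B * A' else A j * B'), (B * B').
split=> [||j]; first exact: dhomogM.
  by rewrite rmorphM mulf_neq0.
rewrite ltnS leq_eqVlt; case: eqVneq => [-> _ | _ /= /AB[homA ->]].
  by split; [exact: dhomogM | rewrite !rmorphM -mulf_div divff // mul1r].
by split; [exact: dhomogM | rewrite !rmorphM -mulf_div divff // mulr1].
Qed.

End GenericPoints.


Lemma size_poly_mull_leq (R : idomainType) (p q : {poly R}) :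
  p * q != 0 -> (size q <= size (p * q)%R)%N.
Proof.
move=> nz; have := nz; rewrite mulf_eq0 negb_or => /andP[nzp nzq].
by rewrite size_mul // -(prednK (n := size p)) ?size_poly_gt0 // addSn leq_addl.
Qed.

(** * The generic line through the center *)

Section ProjectionDegree.

Variables (k : fieldType) (n : nat) (P : 'rV[k]_n.+2) (i : 'I_n.+2).
Hypothesis Pi : P 0 i != 0.
Variable M : 'M[k]_(n.+2, n.+1).
Hypothesis M_proj : projection_from P M.
Variables (d : nat) (F : {mpoly k[n.+2]}).
Hypotheses (F_homog : F \is d.-homog) (F_neq0 : F != 0).
Variables (E : fieldType) (cE : {rmorphism k -> E}) (y : 'rV[E]_n.+1).
Hypothesis E_kPn : function_field 0 cE y.
Variables (L : fieldExtType E) (x : 'rV[L]_n.+2).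
Local Notation cL := (in_alg L \o cE).
Hypothesis L_kX : function_field F cL x.
Hypothesis y0 : y 0 0 = 1.
Hypothesis xM : x *m map_mx cL M = map_mx (in_alg L) y.

Local Notation sec := (section_mx P i M).

(** The parameter of the generic point [x] on its line through [P]: the value at [x] of the variable
    of [line_expand]. *)
Definition fiber_coord : L := x 0 i / cL (P 0 i).
Local Notation t := fiber_coord.

Lemma generic_point_line :
  x = t *: map_mx cL P + map_mx (in_alg L) (y *m map_mx cE sec).
Proof.
rewrite map_mxM -xM -map_mx_comp -mulmxA -map_mxM mul_section_mx //.
rewrite /line_proj map_mxB map_mx1 map_mxZ map_mxM map_delta_mx.
rewrite mulmxBr mulmx1 -scalemxAr mulmxA.
have -> : x *m delta_mx i (0 : 'I_1) = (x 0 i)%:M.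
  by apply/matrixP=> a b; rewrite !ord1 -colE !mxE eqxx mulr1n.
by rewrite mul_scalar_mx scalerA fmorphV mulrC addrC subrK.
Qed.

Lemma generic_coord j :
  x 0 j = t * cL (P 0 j) + ((y *m map_mx cE sec) 0 j)%:A.
Proof. by rewrite {1}generic_point_line !mxE. Qed.

Lemma eval_generic_alg (G : {mpoly k[n.+1]}) :
  eval_at cL (map_mx (in_alg L) y) G = (eval_at cE y G)%:A.
Proof.
apply: (mpoly_rmorph_ext (f := eval_at cL (map_mx (in_alg L) y))
  (g := in_alg L \o eval_at cE y)) G => [a | j] /=.
  by rewrite !eval_atC.
by rewrite !eval_atX mxE.
Qed.

(** The coordinates of [x] are affine functions of [t] over [E], and every element of [L] is a
    quotient of forms in them. *)
Lemma gen_fiber_coord : <<1; t>>%VS = {:L}%VS.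
Proof.
apply/eqP; rewrite eqEsubv subvf; apply/subvP=> z _.
have algK (a : E) : a%:A \in <<1; t>>%VS.
  by rewrite (subvP (subv_adjoin _ _)) // memvZ // mem1v.
have evK G : eval_at cL x G \in <<1; t>>%VS.
  rewrite /eval_at /mmap; apply: rpred_sum => mu _; apply: rpredM; first exact: algK.
  apply: rpred_prod => j _; apply: rpredX; rewrite generic_coord.
  by apply: rpredD; [apply: rpredM; [exact: memv_adjoin | exact: algK] | exact: algK].
have [e [A [B [_ _ _ ->]]]] := L_kX.2 z.
exact: rpred_div.
Qed.

Lemma fiber_equation :
  exists2 q : {poly E}, q != 0 /\ (size q <= size (line_expand P i F))%N
                        & root (map_poly (in_alg L) q) t.
Proof.
pose ev := eval_at cE (y *m map_mx cE sec).
exists (map_poly ev (line_expand P i F)); [split|].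
(* If all coefficients vanished at the generic [y], the coefficient forms composed with [sec] would
   be zero, and [line_expandK] would give [F = 0]. *)
- apply: contraNneq F_neq0 => q0.
  rewrite -(line_expandK Pi F) -(mul_section_mx Pi M_proj).
  suff -> : map_poly (lin_subst (M *m sec)) (line_expand P i F) = 0.
    by rewrite horner0.
  apply/polyP=> j; rewrite coef_map coef0 /= -lin_subst_comp.
  suff -> : lin_subst sec (line_expand P i F)`_j = 0 by rewrite rmorph0.
  have homj : (line_expand P i F)`_j \is (d - j).-homog.
    apply/dhomogP=> m; rewrite mcoeff_msupp.
    by move/(line_expand_graded F_homog) => <-; rewrite addnK.
  apply/eqP; rewrite -(eval_generic_eq0 E_kPn (lin_subst_homog sec homj)).
  rewrite eval_lin_subst; have := congr1 (fun q : {poly E} => q`_j) q0.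
  by rewrite coef_map coef0 => /= /eqP.
- exact: size_poly.
rewrite /root -map_poly_comp; apply/eqP.
have -> : (map_poly (in_alg L \o ev) (line_expand P i F)).[t] = eval_at cL x F.
  apply: (line_expand_horner (f := eval_at cL x)) => [a | j] /=.
    by rewrite /ev !eval_atC.
  rewrite /ev !eval_atC !eval_atX generic_coord mulrC; congr (_ + _).
  case: eqP => // ->; rewrite mxE big1 ?scale0r // => l _.
  by rewrite [map_mx _ _ _ _]mxE section_mx_i // rmorph0 mulr0.
by apply/(L_kX.1 _ _ F_homog); exists 1; rewrite mul1r.
Qed.

Lemma fiber_degree_min (r : {poly E}) :
  r != 0 -> root (map_poly (in_alg L) r) t ->
  (size (line_expand P i F) <= size r)%N.
Proof.
move=> nzr rt.
(* Clearing denominators and homogenising turns r into a form G vanishing at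
   x, hence divisible by F; the degree of G along the lines through P is that
   of r. *)
have [e [A [B [homB nzB AB]]]] := common_denominator E_kPn (nth 0 r) (size r).
pose R := (size r).-1; have r_gt0 : (0 < size r)%N by rewrite size_poly_gt0.
(* At [x], the form [T] takes the value [t] and [W] takes the value [y 0 0 = 1]: powers of [W]
   equalise the degrees without changing the value. *)
pose W := lin_subst M 'X_0; pose T : {mpoly k[n.+2]} := (P 0 i)^-1 *: 'X_i.
have [_ PM] := M_proj.
pose G := \sum_(j < size r) lin_subst M (A j) * T ^+ j * W ^+ (R - j).
have evM H : eval_at cL x (lin_subst M H) = (eval_at cE y H)%:A.
  by rewrite eval_lin_subst xM eval_generic_alg.
have homX l : ('X_l : {mpoly k[n.+1]}) \is 1.-homog by rewrite dhomogX /= mdeg1.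
have homXn (H : {mpoly k[n.+2]}) a : H \is 1.-homog -> H ^+ a \is (a : nat).-homog.
  by move=> /(@dhomogMn _ _ _ _ _ a); rewrite mul1n.
have homG : G \is (e + R).-homog.
  apply: rpred_sum => j _; have le_j : (j <= R)%N by rewrite -ltnS prednK.
  rewrite -[R in (e + R)%N](subnKC le_j) addnA; apply: dhomogM; last first.
    by apply: homXn; apply: lin_subst_homog.
  apply: dhomogM; first by have [homA _] := AB j (ltn_ord j); apply: lin_subst_homog.
  by apply: homXn; apply: dhomogZ; rewrite dhomogX /= mdeg1.
have ev_G : eval_at cL x G = 0.
  suff -> : eval_at cL x G = (eval_at cE y B)%:A * (map_poly (in_alg L) r).[t].
    by rewrite (eqP rt) mulr0.
  rewrite rmorph_sum /= (@horner_coef_wide _ (size r)) ?size_map_poly // mulr_sumr.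
  apply: eq_bigr => j _; rewrite !rmorphM !rmorphXn /= !evM eval_atX y0 scale1r.
  rewrite expr1n mulr1 coef_map /= mulrA; congr (_ * _).
    have [_ ->] := AB j (ltn_ord j).
    by rewrite -scalerAl mul1r scalerA mulrC divfK.
  by rewrite eval_atZ eval_atX fmorphV mulrC.
have [Q defG] := (L_kX.1 _ _ homG).1 ev_G.
(* As [P *m M = 0], forms pulled back by [M] are constant along the lines through [P]; [v] is their
   restriction to [X_i = 0]. *)
pose X' l : {mpoly k[n.+2]} := if l == i then 0 else 'X_l.
pose v := mmap (@mpolyC n.+2 k) (fun j => \sum_l M l j *: X' l) : {mpoly k[n.+1]} -> _.
have vE H : line_expand P i (lin_subst M H) = (v H)%:P.
  apply: (mpoly_rmorph_ext (f := line_expand P i \o lin_subst M)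
    (g := polyC \o mmap (@mpolyC n.+2 k) (fun j => \sum_l M l j *: X' l))) H
    => [a | j] /=.
    by rewrite lin_substC line_expandC mmapC.
  rewrite lin_substX mmapX mmap1U !raddf_sum /=.
  under eq_bigr => l _ do rewrite line_expandZ line_expandX scalerDr scalerA -rmorphM /=.
  rewrite big_split /= -scaler_suml -raddf_sum /=.
  have -> : \sum_l M l j * P 0 l = (P *m M) 0 j.
    by rewrite mxE; apply: eq_bigr => l _; rewrite mulrC.
  rewrite PM mxE scale0r add0r; apply: eq_bigr => l _.
  by rewrite -mul_polyC -polyCM mul_mpolyC.
have v_neq0 H : H != 0 -> v H != 0.
  apply: contraNneq => vH0.
  have MH0 : lin_subst M H = 0.
    by apply: (line_expand_inj Pi); rewrite vE vH0 !rmorph0.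
  by rewrite -[H]lin_subst1 -(section_mxK i M_proj) -lin_subst_comp MH0 rmorph0.
have expT : line_expand P i T = 'X.
  rewrite line_expandZ line_expandX eqxx addr0 scalerA -rmorphM /= mulVf //.
  by rewrite rmorph1 scale1r.
have expG : line_expand P i G =
    \poly_(j < size r) (v (A j) * v 'X_0 ^+ (R - j)).
  rewrite poly_def raddf_sum; apply: eq_bigr => j _ /=.
  by rewrite !rmorphM !rmorphXn /= expT !vE -mul_polyC polyCM polyC_exp mulrAC.
(* The exponent [R - R] of the padding is zero, so the top coefficient of the expansion of [G] is
   [v (A R)]. *)
have AR : A R != 0.
  have [_] := AB R (ltac:(by rewrite prednK)); apply: contra_eq_neq => ->.
  by rewrite rmorph0 mul0r -lead_coefE lead_coef_eq0.
have size_G : size (line_expand P i G) = size r.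
  by rewrite expG size_poly_eq // subnn expr0 mulr1 v_neq0.
have defE : line_expand P i G = line_expand P i Q * line_expand P i F.
  by rewrite defG rmorphM.
clearbody G; move: size_G; rewrite defE => size_QF.
have nzQF : line_expand P i Q * line_expand P i F != 0.
  by rewrite -size_poly_gt0 size_QF.
have := size_poly_mull_leq nzQF; rewrite size_QF; exact.
Qed.

(** The dimension is the degree of the minimal polynomial of [t] over [E]: [fiber_equation] bounds
    it from above and [fiber_degree_min] from below. *)
Lemma projection_degree : \dim {:L} = (size (line_expand P i F)).-1.
Proof.
have -> : \dim {:L} = (size (minPoly 1 t)).-1.
  by rewrite size_minPoly -gen_fiber_coord dim_Fadjoin dimv1 muln1.
congr (_.-1); apply/eqP; rewrite eqn_leq; apply/andP; split.
  have [q [nzq le_q] qt] := fiber_equation; apply: leq_trans le_q.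
  rewrite -(size_map_poly (in_alg L)); apply: dvdp_leq.
    by rewrite map_poly_eq0.
  by apply: minPoly_dvdp => //; apply/polyOver1P; exists q.
have /polyOver1P[r defr] := minPolyOver 1%AS t.
rewrite defr size_map_poly; apply: fiber_degree_min.
  by rewrite -(map_poly_eq0 (in_alg L)) -defr monic_neq0 ?monic_minPoly.
by rewrite -defr root_minPoly.
Qed.

Lemma linear_gal_affine (s : L -> L) (A : 'M[k]_n.+2) :
    (0 < n)%N -> (2 < d)%N -> (forall a : E, s a%:A = a%:A) ->
    linear_pullback F cL x cL x A s ->
  exists ab : E * E, s t = ab.1 *: t + ab.2%:A.
Proof.
move=> n_gt0 d_gt2 s_id pull; have [_ PM] := M_proj.
pose lam := (x *m map_mx cL (A *m M)) 0 0.
have homX N l : ('X_l : {mpoly k[N]}) \is 1.-homog by rewrite dhomogX /= mdeg1.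
have xMj j : eval_at cL x (lin_subst M 'X_j) = (y 0 j)%:A.
  by rewrite eval_lin_subst xM eval_atX mxE.
have xAMj j : eval_at cL (x *m map_mx cL A) (lin_subst M 'X_j) =
    (x *m map_mx cL (A *m M)) 0 j.
  by rewrite eval_lin_subst -mulmxA -map_mxM eval_atX.
have homM j : lin_subst M 'X_j \is 1.-homog by apply: lin_subst_homog.
have nF0 : ~ mpoly_dvd F (lin_subst M 'X_0).
  move/(L_kX.1 _ _ (homM _)); rewrite xMj y0 => /eqP.
  by rewrite scale1r oner_eq0.
(* As [s] fixes [E], the points [x] and [x A] have the same projection. *)
have s_xM j : (y 0 j)%:A = (x *m map_mx cL (A *m M)) 0 j / lam.
  have := pull _ _ _ (homM j) (homM 0) nF0.
  by rewrite !xAMj !xMj y0 scale1r divr1 s_id.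
have nz_lam : lam != 0.
  apply/eqP => lam0; have := s_xM 0; rewrite lam0 invr0 mulr0 y0 scale1r.
  by move/eqP; rewrite oner_eq0.
(* The quadratic forms (x A M)_j (x M)_0 - (x A M)_0 (x M)_j vanish on V(F),
   whose degree is d > 2: they are zero, i.e. v A M is proportional to v M for
   every vector v.  As P M = 0, comparing v and v + P gives P A M = 0. *)
have PAM0 : P *m (A *m M) = 0.
  have prop (v : 'rV[k]_n.+2) j :
      (v *m (A *m M)) 0 j * (v *m M) 0 0 = (v *m (A *m M)) 0 0 * (v *m M) 0 j.
    pose G := lin_subst (A *m M) 'X_j * lin_subst M 'X_0
            - lin_subst (A *m M) 'X_0 * lin_subst M 'X_j.
    have homG : G \is 2.-homog.
      by apply: rpredB; apply: (dhomogM (d := 1) (e := 1)); apply: lin_subst_homog.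
    have G0 : G = 0.
      apply: (mpoly_dvd_small F_homog F_neq0 homG d_gt2).
      apply/(L_kX.1 _ _ homG); rewrite /G raddfB /= !(rmorphM (eval_at cL x)) /= !xMj.
      rewrite y0 scale1r mulr1.
      by rewrite !eval_lin_subst !eval_atX s_xM mulrC divfK // subrr.
    have := congr1 (eval_at idfun v) G0.
    rewrite /G raddfB raddf0 /= !(rmorphM (eval_at idfun v)) /= !eval_lin_subst !eval_atX !map_mx_id //.
    by move/eqP; rewrite subr_eq0 => /eqP.
  have addE N (u w : 'rV[k]_N) j : (u + w) 0 j = u 0 j + w 0 j by rewrite mxE.
  have propP (v : 'rV[k]_n.+1) j :
      (P *m (A *m M)) 0 j * v 0 0 = (P *m (A *m M)) 0 0 * v 0 j.
    have := prop (P + v *m sec) j; rewrite !mulmxDl PM add0r.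
    rewrite -(mulmxA v sec M) (section_mxK i M_proj) mulmx1 !addE.
    have := prop (v *m sec) j.
    rewrite -(mulmxA v sec M) (section_mxK i M_proj) mulmx1 !mulrDl => ->.
    by move/addIr.
  (* The target has a second coordinate because [n > 0]; its basis vector forces the first entry to
     vanish. *)
  have PAM00 : (P *m (A *m M)) 0 0 = 0.
    have n1 : (1 < n.+1)%N by [].
    have := propP (delta_mx 0 (Ordinal n1)) (Ordinal n1).
    by rewrite !mxE !eqxx /= mulr1 mulr0 => <-.
  apply/rowP=> j; rewrite [RHS]mxE.
  by have := propP (delta_mx 0 0) j; rewrite PAM00 mul0r [delta_mx _ _ _ _]mxE !eqxx mulr1.
(* The multiple of [P] in [x] contributes nothing, so the denominator [lam] lies in [E]. *)
have lamE : lam = ((y *m map_mx cE sec *m map_mx cE (A *m M)) 0 0)%:A.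
  rewrite /lam {1}generic_point_line mulmxDl -scalemxAl -map_mxM PAM0.
  by rewrite map_mx0 scaler0 add0r map_mx_comp -map_mxM [LHS]mxE.
pose mu := (y *m map_mx cE sec *m map_mx cE (A *m M)) 0 0.
(* [t] is written as a quotient of linear forms; the factor [lin_subst M 'X_0], of value 1 at [x],
   gives the constant [P 0 i] degree one. *)
have pullt : s t = (x *m map_mx cL A) 0 i / (cL (P 0 i) * lam).
  have homPX : P 0 i *: lin_subst M 'X_0 \is 1.-homog by apply: dhomogZ.
  have evPX : eval_at cL x (P 0 i *: lin_subst M 'X_0) = cL (P 0 i).
    by rewrite eval_atZ xMj y0 scale1r mulr1.
  have nF : ~ mpoly_dvd F (P 0 i *: lin_subst M 'X_0).
    by move/(L_kX.1 _ _ homPX)/eqP; rewrite evPX fmorph_eq0; apply/negP.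
  have := pull _ _ _ (homX _ i) homPX nF.
  by rewrite evPX eval_atZ xAMj !eval_atX.
have xAi : (x *m map_mx cL A) 0 i =
    t * cL ((P *m A) 0 i) + ((y *m map_mx cE sec *m map_mx cE A) 0 i)%:A.
  rewrite {1}generic_point_line mulmxDl -scalemxAl -map_mxM mxE.
  by rewrite map_mx_comp -map_mxM !mxE.
pose r := (cE (P 0 i) * mu)^-1.
exists (r * cE ((P *m A) 0 i), r * (y *m map_mx cE sec *m map_mx cE A) 0 i) => /=.
have -> : s t = r *: (x *m map_mx cL A) 0 i.
  have invE : (r%:A : L) = (cL (P 0 i) * mu%:A)^-1.
    have -> : cL (P 0 i) * mu%:A = in_alg L (cE (P 0 i) * mu) by rewrite rmorphM.
    by rewrite -fmorphV.
  by rewrite pullt lamE -/mu -invE mulr_algr.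
by rewrite xAi scalerDr /= mulr_algr !scalerA.
Qed.

End ProjectionDegree.

(** * Galois groups of affine transformations *)

Section AffineGalois.

Variables (E : fieldType) (L : splittingFieldType E) (t : L).
Hypothesis gen_t : <<1; t>>%VS = {:L}%VS.
Hypothesis t_notin1 : t \notin 1%VS.

Local Notation G := 'Gal({:L}%AS / 1%AS)%g.

Lemma gal_scale (s : gal_of {:L}%AS) (a : E) (z : L) : s (a *: z) = a *: s z.
Proof. by rewrite linearZ. Qed.

Lemma gal_alg (s : gal_of {:L}%AS) (b : E) : s b%:A = b%:A.
Proof. by rewrite linearZ /= rmorph1. Qed.

Lemma gal_gen_inj (s s' : gal_of {:L}%AS) : s t = s' t -> s = s'.
Proof.
move=> eq_st; apply/eqP/gal_eqP => z _.
have zK : z \in <<1; t>>%VS by rewrite gen_t memvf.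
rewrite -(Fadjoin_poly_eq zK).
have /polyOver1P[q ->] := Fadjoin_polyOver 1%AS t z.
rewrite -!horner_map /= eq_st -!map_poly_comp.
by rewrite (eq_map_poly (gal_alg s)) (eq_map_poly (gal_alg s')).
Qed.

(** [1] and [t] are linearly independent over [E], as [t] is not in [E]. *)
Lemma affine_uniq (a b a' b' : E) :
  a *: t + b%:A = a' *: t + b'%:A -> a = a' /\ b = b'.
Proof.
move=> eq_ab; case: (eqVneq a a') => [eq_a | neq_a].
  split=> //; move: eq_ab; rewrite eq_a => /addrI/eqP.
  by rewrite -subr_eq0 -scalerBl scaler_eq0 oner_eq0 orbF subr_eq0 => /eqP.
case/negP: t_notin1; have nz : a - a' != 0 by rewrite subr_eq0.
suff -> : t = ((a - a')^-1 * (b' - b))%:A by rewrite memvZ // mem1v.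
rewrite -scalerA; apply: (canRL (scalerK nz)).
rewrite !scalerBl; apply/eqP; rewrite subr_eq addrAC eq_sym subr_eq addrC.
by rewrite eq_sym [_ *: _ + _]addrC addrC eq_ab addrC.
Qed.

Lemma affine_galois_group (p u l : nat) :
    p \in [pchar E] -> (#|G| = p ^ u * l)%N -> (0 < u)%N -> coprime p l ->
    (forall s, s \in G -> exists ab : E * E, s t = ab.1 *: t + ab.2%:A) ->
  (l %| p ^ u - 1)%N /\
  exists N H : {group gal_of {:L}%AS},
    [/\ (N ><| H)%g = G, (N \isog [set: 'rV['F_p]_u])%g & (H \isog Zp l)%g].
Proof.
move=> charEp cardG u_gt0 p_l affG.
have p_pr : prime p := pcharf_prime charEp.
have p_gt1 := prime_gt1 p_pr.
have l_gt0 : (0 < l)%N.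
  by rewrite lt0n; apply: contraTneq (cardG_gt0 G) => l0; rewrite cardG l0 muln0.
have [ab abE] : exists ab : gal_of {:L}%AS -> E * E,
    forall s, s \in G -> s t = (ab s).1 *: t + (ab s).2%:A.
  apply: (fin_all_exists (P := fun s (ab : E * E) =>
    s \in G -> s t = ab.1 *: t + ab.2%:A)) => s; case: (boolP (s \in G)) => [/affG[ab stE]|_].
    by exists ab.
  by exists (0, 0).
pose a s := (ab s).1; pose b s := (ab s).2.
have galM_t (s s' : gal_of {:L}%AS) : (s * s')%g t = s' (s t).
  by rewrite galM ?memvf.
(* In the product [s] acts first, and [s'] fixes the coefficients [a s] and [b s]. *)
have abM : {in G &, forall s s', a (s * s')%g = a s * a s' /\
                                 b (s * s')%g = a s * b s' + b s}.
  move=> s s' Gs Gs'; apply: affine_uniq; rewrite -abE ?groupM // galM_t.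
  rewrite (abE s) // raddfD /= gal_scale gal_alg abE // scalerDr !scalerA.
  by rewrite scalerDl addrA.
have aM : {in G &, {morph a : s s' / (s * s')%g >-> s * s'}}.
  by move=> s s' Gs Gs'; case: (abM s s' Gs Gs').
have ab1 s : s \in G -> (s = 1%g) <-> (a s = 1 /\ b s = 0).
  move=> Gs; split=> [s1 | [a1 b0]].
    apply: affine_uniq; rewrite -abE // s1 gal_id scale1r scale0r addr0 //.
  apply: gal_gen_inj; rewrite abE // -/(a s) -/(b s) a1 b0 scale1r scale0r addr0.
  by rewrite gal_id.
have a1 : a 1%g = 1 by have [] := (ab1 1%g (group1 _)).1 erefl.
have aX s j : s \in G -> a (s ^+ j)%g = a s ^+ j.
  move=> Gs; elim: j => [|j IHj]; first by rewrite expg0 expr0.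
  by rewrite expgS exprS aM ?groupX // IHj.
pose N := [set s in G | a s == 1].
have gN : group_set N.
  apply/group_setP; split; first by rewrite inE group1 a1 eqxx.
  move=> s s'; rewrite !inE => /andP[Gs /eqP as1] /andP[Gs' /eqP as1'].
  by rewrite groupM // aM // as1 as1' mulr1 eqxx.
pose K := Group gN.
have inN s : (s \in K) = (s \in G) && (a s == 1) by rewrite inE.
have sNG : K \subset G by apply/subsetP => s; rewrite inN => /andP[].
have bN : {in K &, forall s s', b (s * s')%g = b s' + b s}.
  move=> s s'; rewrite !inN => /andP[Gs /eqP as1] /andP[Gs' _].
  by have [_ ->] := abM s s' Gs Gs'; rewrite as1 mul1r.
have N1 s : s \in K -> b s = 0 -> s = 1%g.
  by rewrite inN => /andP[Gs /eqP as1] bs0; apply/ab1.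
have b1 : b 1%g = 0 by have [] := (ab1 1%g (group1 _)).1 erefl.
(* [b] embeds [K] in the additive group of [E], which is commutative and killed by [p]. *)
have abelN : (p.-abelem K)%g.
  apply/abelemP=> //; split.
    apply/centsP => s Ns s' Ns'; apply: gal_gen_inj.
    have Gss := subsetP sNG _ (groupM Ns Ns').
    have Gss' := subsetP sNG _ (groupM Ns' Ns).
    rewrite abE // (abE (s' * s)%g) // -/(a _) -/(b _) -/(a (s' * s)%g) -/(b (s' * s)%g).
    rewrite !bN // addrC [b s' + _]addrC !aM ?(subsetP sNG) //.
    by rewrite [a s * _]mulrC addrC.
  move=> s Ns; apply: N1; first exact: groupX.
  have bX j : b (s ^+ j)%g = b s *+ j.
    elim: j => [|j IHj]; first by rewrite expg0 b1.
    by rewrite expgS mulrSr bN ?groupX // IHj.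
  by rewrite bX mulrn_pchar.
have nNG : (K <| G)%g.
  rewrite /normal sNG; apply/normsP=> s Gs; apply/eqP.
  rewrite eqEcard cardJg leqnn andbT; apply/subsetP => _ /imsetP[z + ->].
  rewrite !inN => /andP[Gz /eqP az1].
  rewrite groupJ //= conjgE !aM ?groupM ?groupV // az1 mul1r -aM ?groupV //.
  by rewrite mulVg a1.
(* An element [s] of a Sylow subgroup containing [K] has order a power of [p], so
   [(a s - 1) ^+ (p ^ j) = 0] by Frobenius, whence [a s = 1]. *)
have sylN : (p.-Sylow(G) K)%g.
  have [S sylS sNS] := Sylow_superset sNG (abelem_pgroup abelN).
  suff -> : K = S by [].
  apply/eqP; rewrite eq_sym -val_eqE /= eqEsubset sNS andbT.
  apply/subsetP => s Ss; have Gs := subsetP (pHall_sub sylS) s Ss.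
  rewrite inE Gs /=.
  have /p_natP[j sj] : (p.-nat #[s])%g by apply: mem_p_elt (pHall_pgroup sylS) Ss.
  have /eqP : a s ^+ (p ^ j) = 1 by rewrite -aX // -sj expg_order.
  rewrite -subr_eq0 -[1](expr1n _ (p ^ j)%N) => sj0; rewrite -subr_eq0; move: sj0.
  have <- : (a s - 1) ^+ (p ^ j) = a s ^+ (p ^ j) - 1 ^+ (p ^ j).
    elim: j {sj} => [|j IHj]; first by rewrite !expr1.
    by rewrite expnSr !exprM IHj -!(pFrobenius_autE charEp) rmorphB.
  by rewrite expr1n expf_eq0 => /andP[].
have cardN : #|K| = (p ^ u)%N.
  rewrite (card_Hall sylN) cardG p_part lognM ?expn_gt0 ?(ltnW p_gt1) //.
  by rewrite pfactorK // logn_coprime // addn0.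
have /splitsP[H /complP[tiNH defG]] :=
  SchurZassenhaus_split (pHall_Hall sylN) nNG.
have sHG : H \subset G by rewrite -defG mulG_subr.
have cardH : #|H| = l.
  have := TI_cardMg tiNH; rewrite defG cardG cardN => /eqP.
  by rewrite eqn_pmul2l ?expn_gt0 ?(ltnW p_gt1) // => /eqP.
have aH s : s \in H -> a s = 1 -> s = 1%g.
  move=> Hs as1; apply/set1gP; rewrite -tiNH inE Hs andbT.
  by rewrite inN (subsetP sHG s Hs) as1 eqxx.
(* [a] is injective on [H], since [H] meets its kernel [K] trivially; finite multiplicative groups
   in a field are cyclic. *)
have cycH : cyclic H.
  apply: (@field_mul_group_cyclic _ _ _ a).
    by move=> s s' Hs Hs' /=; apply: aM; apply: (subsetP sHG).
  move=> s Hs; split=> [|->]; [exact: aH | exact: a1].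
have nNH : H \subset ('N(K))%g := subset_trans sHG (normal_norm nNG).
(* If [z] in [K] commutes with [s], then [a s * b z = b z], so [b z = 0] or [a s = 1]. *)
have regH : semiregular K H.
  move=> s; rewrite !inE => /andP[s_neq1 Hs]; apply/trivgP/subsetP => z.
  rewrite in_setI inN => /andP[/andP[Gz /eqP az1] /cent1P zs]; rewrite inE.
  have Gs := subsetP sHG s Hs.
  have [_ bzs] := abM z s Gz Gs; have [_ bsz] := abM s z Gs Gz.
  apply/eqP/ab1 => //; split=> //.
  have : a s * b z + b s = b z + b s by rewrite -bsz -zs bzs az1 mul1r addrC.
  move/addIr/eqP; rewrite -subr_eq0 -{2}[b z]mul1r -mulrBl mulf_eq0 subr_eq0.
  by case/orP=> /eqP // as1; rewrite (aH s) ?eqxx in s_neq1.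
(* [H] permutes the nontrivial elements of [K] in orbits of length [l]. *)
split; first by rewrite -cardN -cardH subn1 regular_norm_dvd_pred.
exists K, H; split; first by rewrite sdprodE.
  rewrite (isog_abelem_card _ abelN) mx_Fp_abelem //= cardsT card_mx mul1n.
  by rewrite card_Fp // cardN eqxx.
rewrite isog_cyclic_card // cardH.
have -> : #|Zp l| = l by rewrite card_Zp.
(* [Zp l] is by definition the trivial group unless [l > 1]. *)
rewrite eqxx andbT /= /Zp; case: ifP => _; last exact: cyclic1.
by apply/cyclicP; exists Zp1; apply: Zp_cycle.
Qed.

End AffineGalois.

(* E = k(P^n) and L = k(X); the field extension induced by the projection is
   L / E, so that P is a Galois point when L / E is Galois. *)
Theorem theorem1p2
  (k : closedFieldType) (p : nat) (charkp : p \in [pchar k])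
  (n : nat) (n_gt0 : (0 < n)%N)
  (d : nat) (d_ge3 : (3 <= d)%N)
  (F : {mpoly k[n.+2]}) (F_homog : F \is d.-homog)
  (F_irr : mpoly_irreducible F)
  (P : 'rV[k]_n.+2) (P_neq0 : P != 0)
  (m : nat) (m_def : m = multiplicity F P) (dominant : (m < d)%N)
  (M : 'M[k]_(n.+2, n.+1)) (M_proj : projection_from P M)
  (E : fieldType) (cE : {rmorphism k -> E}) (y : 'rV[E]_n.+1)
  (E_kPn : function_field 0 cE y)
  (L : splittingFieldType E) (x : 'rV[L]_n.+2)
  (L_kX : function_field F (in_alg L \o cE) x)
  (L_over_E : linear_pullback 0 cE y (in_alg L \o cE) x M (in_alg L))
  (P_galois : galois 1%AS {:L}%AS)
  (P_extendable : forall s : gal_of {:L}%AS, s \in 'Gal({:L}%AS / 1%AS)%g ->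
     linearly_induced F (in_alg L \o cE) x s)
  (p_dvd : (p %| d - m)%N)
  (u l : nat) (dm_eq : (d - m = p ^ u * l)%N) (p_l : coprime p l) :
  (l %| p ^ u - 1)%N /\
  exists N H : {group gal_of {:L}%AS},
    [/\ (N ><| H)%g = 'Gal({:L}%AS / 1%AS)%g,
        (N \isog [set: 'rV['F_p]_u])%g
      & (H \isog Zp l)%g].
Proof.
have nzF : F != 0 by have [] := F_irr.
have [i nzPi mE] : exists2 i, P 0 i != 0 & m = mpoly_order (local_equation F P i).
  rewrite m_def /multiplicity; case: pickP => [i nzPi | P0]; first by exists i.
  case/negP: P_neq0; apply/eqP/rowP => j; rewrite mxE; apply/eqP.
  by have /negbFE := P0 j.
have dmE : (size (line_expand P i F)).-1 = (d - m)%N.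
  by rewrite -[in RHS](order_line_expand nzPi nzF F_homog) mE addKn.
pose cL : {rmorphism k -> L} := in_alg L \o cE.
have homX N (j : 'I_N) : ('X_j : {mpoly k[N]}) \is 1.-homog.
  by rewrite dhomogX /= mdeg1.
have nX0 : ~ mpoly_dvd 0 ('X_0 : {mpoly k[n.+1]}).
  by case=> Q /eqP; rewrite mulr0 -msupp_eq0 msuppX.
have nz_y0 : y 0 0 != 0.
  rewrite -(eval_atX cE y 0); apply/eqP.
  by move/(E_kPn.1 _ _ (homX _ _)).
have nz_xM0 : (x *m map_mx cL M) 0 0 != 0.
  apply/eqP => xM0; have := L_over_E _ _ _ (homX _ 0) (homX _ 0) nX0.
  rewrite !eval_atX xM0 mul0r divff // rmorph1 => /eqP; rewrite oner_eq0 //.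
(* The pullback hypothesis only compares ratios of coordinates; after this normalisation the
   projection of [x'] is exactly [y']. *)
pose y' := (y 0 0)^-1 *: y; pose x' := ((x *m map_mx cL M) 0 0)^-1 *: x.
have E_kPn' : function_field 0 cE y' by apply: function_field_scale; rewrite ?invr_neq0.
have L_kX' : function_field F cL x' by apply: function_field_scale; rewrite ?invr_neq0.
have y0' : y' 0 0 = 1 by rewrite mxE mulVf.
have xM' : x' *m map_mx cL M = map_mx (in_alg L) y'.
  apply/rowP=> j; have := L_over_E _ _ _ (homX _ j) (homX _ 0) nX0; rewrite !eval_atX => yj.
  by rewrite -scalemxAl [LHS]mxE [RHS]mxE [y' 0 j]mxE mulrC -yj mulrC.
have dimL := projection_degree nzPi M_proj F_homog nzF E_kPn' L_kX' y0' xM'.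
have gen_t := gen_fiber_coord nzPi M_proj L_kX' xM'.
have cardG : #|'Gal({:L}%AS / 1%AS)%g| = (p ^ u * l)%N.
  by rewrite -(galois_dim P_galois) dimv1 divn1 dimL dmE.
have p_pr : prime p := pcharf_prime charkp.
have charEp : p \in [pchar E] by rewrite (fmorph_pchar cE).
have u_gt0 : (0 < u)%N.
  rewrite lt0n; apply: contraTneq p_dvd => u0.
  by rewrite dm_eq u0 mul1n -prime_coprime.
apply: (affine_galois_group gen_t _ charEp cardG u_gt0 p_l) => [|s Gs].
  (* If [t] were in [E], then [L = E] and [d - m = 1], which [p] does not divide. *)
  apply: contraTN p_dvd => t1; rewrite -dmE -dimL -gen_t.
  by rewrite (Fadjoin_idP t1) dimv1 dvdn1 neq_ltn prime_gt1 ?orbT.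
have [A [_ _ pull]] := P_extendable _ Gs.
apply: (linear_gal_affine nzPi M_proj F_homog nzF L_kX' y0' xM' n_gt0 d_ge3).
  by move=> a; apply: gal_alg.
by apply: linear_pullback_scale pull; rewrite ?invr_neq0.
Qed.
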